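(* Let $p$ and $q$ be nonnegative integers with $p+q>0$. Then every $(p,q)$-tilted Sperner family with patterns $\mathcal{F}\subseteq\mathcal{P}([n])$ satisfies $$|\mathcal{F}| \le O\left(\sqrt{\log n}\,\frac{2^n}{\sqrt{n}}\right).$$ That is, there is a constant $C=C(p,q)$, depending only on $p$ and $q$, such that for every integer $n\ge 2$ and every $(p,q)$-tilted Sperner family with patterns $\mathcal{F}\subseteq\mathcal{P}([n])$ we have $|\mathcal{F}|\le C\sqrt{\log n}\,\frac{2^n}{\sqrt{n}}$.
   Context: Notation: $[n]=\{1,2,\dots,n\}$ and $\mathcal{P}([n])$ is its power set; $\log$ is the natural logarithm. Definition. Let $p,q$ be nonnegative integers with $p+q>0$. A family $\mathcal{F}\subseteq\mathcal{P}([n])$ is a $(p,q)$-tilted Sperner family with patterns if there are no distinct $F,G\in\mathcal{F}$ satisfying both (i) $p|F\setminus G|=q|G\setminus F|$, and (ii) $f>g$ for all $f\in F\setminus G$ and all $g\in G\setminus F$ (this condition holds vacuously if one of $F\setminus G$, $G\setminus F$ is empty). *)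

(* Defs.v *)
From mathcomp Require Import all_boot.

Set Implicit Arguments.
Unset Strict Implicit.
Unset Printing Implicit Defensive.

(* The ground set [n] = {1, ..., n} is represented by 'I_n = {0, ..., n - 1};
   only the relative order of the elements matters. *)
Definition tilted_sperner_patterns (p q n : nat) (FF : {set {set 'I_n}}) : Prop :=
  ~ exists F G : {set 'I_n},
      [/\ F \in FF, G \in FF, F <> G,
          p * #|F :\: G| = q * #|G :\: F|
        & forall f g : 'I_n, f \in F :\: G -> g \in G :\: F -> g < f].

(* Main.v *)
(* Cut {0, ..., (p + q) m - 1} into m blocks, each made of p elements below p m
   (its low part) and q elements at or above p m (its high part), where
   m = n %/ (p + q).  Call a block active for Z if Z meets it exactly in its low
   part or exactly in its high part.  Replacing the low part by the high part in
   a nonempty set of active blocks produces a forbidden pair, so once the trace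
   of Z outside its active blocks is fixed, the sets of high blocks form an
   antichain in the Boolean lattice of the k(Z) active blocks, of size at most
   2 ^ k / sqrt (k + 1).  Hence |F| is at most the sum of 1 / sqrt (k(Z) + 1)
   over all Z.  Overwriting one block shows that the sum of 1 / (k(Z) + 1) is
   O(2 ^ n / m), and AM-GM gives |F| = O(2 ^ n / sqrt n), without the logarithm. *)
Require Import Defs.
From mathcomp Require Import all_boot all_order all_algebra.
From mathcomp Require Import reals exp.
From mathcomp Require Import zify ring lra.

Import Order.TTheory GRing.Theory Num.Theory.
Local Open Scope ring_scope.

(** * Binomial coefficients are at most 2 ^ k / sqrt (k + 1) *)

Lemma central_bin_sqr_le (j : nat) : ('C(j.*2, j) ^ 2 * j.*2.+1 <= 16 ^ j)%N.
Proof.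
elim: j => [//|j IH].
have h1 : (j.+1 * 'C(j.+1.*2, j.+1) = 2 * j.*2.+1 * 'C(j.*2, j))%N.
  have := mul_bin_down j.*2.+1 j; rewrite (_ : j.*2.+1 - j = j.+1)%N; last by lia.
  have := mul_bin_diag j.*2.+2 j; rewrite /= -doubleS => <- h; lia.
rewrite (expnS 16) -(leq_pmul2l (_ : 0 < j.+1 ^ 2)%N) ?expn_gt0 //.
rewrite mulnA -expnMn h1 !expnMn.
move: IH; set a := ('C(_, _) ^ 2)%N; set b := (16 ^ j)%N; rewrite doubleS -muln2.
(* This is (2j + 1)(2j + 3) <= (2j + 2) ^ 2, which lets the linear factor survive the induction. *)
have h2 : (4 * (j * 2).+1 * (j * 2).+3 <= 16 * j.+1 ^ 2)%N by nia.
move=> /(leq_mul h2); nia.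
Qed.

(* Induction from [(d, b + 1)] to [(d + 2, b)], moving away from the middle. *)
Lemma bin_sqr_le_half (d b : nat) :
  ('C(b.*2 + d, b) ^ 2 * (b.*2 + d).+1 <= 4 ^ (b.*2 + d))%N.
Proof.
elim/ltn_ind: d b => -[_ b|[_ b|d IH b]].
- by rewrite addn0 -mul2n expnM mul2n central_bin_sqr_le.
(* Odd case: C(2b + 2, b + 1) is twice C(2b + 1, b), so the central bound applies. *)
- have := central_bin_sqr_le b.+1.
  rewrite doubleS binS addn1 (_ : 'C(b.*2.+1, b.+1) = 'C(b.*2.+1, b)); last first.
    by rewrite -bin_sub; [congr 'C(_, _)|]; lia.
  rewrite (_ : 16 ^ b.+1 = 4 * 4 ^ b.*2.+1)%N; last first.
    by rewrite -expnS -doubleS -mul2n expnM.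
  set c := 'C(_, _); set e := (4 ^ _)%N; nia.
- apply: leq_trans (_ : 'C(b.+1.*2 + d, b.+1) ^ 2 * (b.+1.*2 + d).+1 <= _)%N.
    rewrite (_ : b.*2 + d.+2 = b.+1.*2 + d)%N; last by lia.
    rewrite leq_mul2r leq_exp2r //.
    have := mul_bin_left (b.+1.*2 + d) b.
    set x := 'C(_, b); set y := 'C(_, b.+1); nia.
  by rewrite (_ : b.*2 + d.+2 = b.+1.*2 + d)%N; [apply: IH|]; lia.
Qed.

Lemma bin_sqr_le (k a : nat) : ('C(k, a) ^ 2 * k.+1 <= 4 ^ k)%N.
Proof.
have half b : (b.*2 <= k)%N -> ('C(k, b) ^ 2 * k.+1 <= 4 ^ k)%N.
  by move=> /subnKC <-; apply: bin_sqr_le_half.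
have [ak|ka] := leqP a k; last by rewrite bin_small.
have [/half//|lt] := leqP a.*2 k.
by rewrite -bin_sub //; apply: half; lia.
Qed.

(** * The LYM inequality and Sperner's bound *)

(* If [D] is not in [A], then [1 / 'C(#|D|, #|X|)] is the average over [x] in [D]
   of the same weight in [D :\ x], counted when [X] avoids [x]. *)
Lemma LYM (R : numFieldType) (I : finType) (D : {set I}) (A : {set {set I}}) :
    {in A, forall X : {set I}, X \subset D} ->
    {in A &, forall X Y : {set I}, X \subset Y -> X = Y} ->
  \sum_(X in A) ('C(#|D|, #|X|)%:R : R)^-1 <= 1.
Proof.
move: {2}#|D| (erefl #|D|) => k; elim: k D A => [|k IH] D A cD sAD antiA.
  have AD X : X \in A -> X = D.
    by move/sAD; rewrite (cards0_eq cD) subset0 => /eqP.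
  have [DA|DA] := boolP (D \in A); last first.
    rewrite big1 ?ler01 // => X XA; move: (XA); rewrite (AD _ XA) => h.
    by rewrite h in DA.
  rewrite (big_pred1 D) ?binn ?invr1 // => X.
  by apply/idP/eqP => [/AD|->].
have [DA|DA] := boolP (D \in A).
  rewrite (big_pred1 D) ?binn ?invr1 // => X.
  by apply/idP/eqP => [XA|->//]; apply: antiA => //; apply: sAD.
have ltA X : X \in A -> (#|X| <= k)%N.
  move=> XA; rewrite -ltnS -cD proper_card // properEneq sAD // andbT.
  by apply: contraNneq DA => <-.
have wE X : X \in A -> ('C(#|D|, #|X|)%:R : R)^-1 =
    \sum_(x in D | x \notin X) (#|D|%:R)^-1 * ('C(k, #|X|)%:R)^-1.
  move=> XA; have lX := ltA _ XA.
  rewrite sumr_const.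
  have -> : #|[pred x | x \in D & x \notin X]| = (#|D| - #|X|)%N.
    rewrite -[in RHS](setIidPr (sAD _ XA)) -cardsD; apply: eq_card => x.
    by rewrite !inE andbC.
  (* Exactly k + 1 - |X| points of [D] avoid [X], and (k + 1) C(k, |X|) = (k + 1 - |X|) C(k + 1,
     |X|). *)
  have /= := mul_bin_down k.+1 #|X|.
  rewrite cD => /(congr1 (fun n => n%:R : R)); rewrite !natrM => e.
  have n0 : k.+1%:R != 0 :> R by rewrite pnatr_eq0.
  have n1 : 'C(k.+1, #|X|)%:R != 0 :> R by rewrite pnatr_eq0 -lt0n bin_gt0 leqW.
  have n2 : 'C(k, #|X|)%:R != 0 :> R by rewrite pnatr_eq0 -lt0n bin_gt0.
  apply: (mulfI (mulf_neq0 n0 n2)); rewrite {1}e mulfK // -invfM.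
  by rewrite mulrnAr mulfV // mulf_neq0.
rewrite (eq_bigr _ wE) (exchange_big_dep (mem D)) /=; last by move=> ? ? _ /andP[].
apply: le_trans (_ : \sum_(x in D) (#|D|%:R : R)^-1 <= 1); last first.
  by rewrite sumr_const -[leLHS]mulr_natr mulVf // pnatr_eq0 cD.
apply: ler_sum => x xD.
rewrite -mulr_sumr -[leRHS]mulr1 ler_wpM2l ?invr_ge0 ?ler0n //.
have cDx : #|D :\ x| = k by move: cD; rewrite (cardsD1 x D) xD => -[].
have := IH (D :\ x) [set X in A | x \notin X] cDx.
rewrite cDx (eq_bigl (fun X => (X \in A) && ((x \in D) && (x \notin X)))).
  apply=> [X /[!inE] /andP[/sAD XD xX]|X Y]; first by rewrite subsetD1 XD.
  by move=> /[!inE] /andP[? _] /andP[? _]; apply: antiA.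
by move=> X; rewrite inE xD.
Qed.

(** The LYM weights sum to at most 1, and by [bin_sqr_le] each is at least sqrt (k + 1) / 2 ^ k,
    where k = |D|. *)
Lemma sperner_sqrt (R : rcfType) (I : finType) (D : {set I}) (A : {set {set I}}) :
    {in A, forall X : {set I}, X \subset D} ->
    {in A &, forall X Y : {set I}, X \subset Y -> X = Y} ->
  #|A|%:R <= 2 ^+ #|D| / Num.sqrt (#|D|.+1%:R) :> R.
Proof.
move=> sAD antiA; rewrite -sum1_card natr_sum.
have s0 : 0 < Num.sqrt (#|D|.+1%:R : R) by rewrite sqrtr_gt0 ltr0n.
have M0 : 0 <= 2 ^+ #|D| / Num.sqrt (#|D|.+1%:R) :> R.
  by rewrite divr_ge0 ?exprn_ge0 // ltW.
rewrite -[leRHS]mulr1; apply: le_trans (ler_wpM2l M0 (@LYM R I D A sAD antiA)).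
rewrite mulr_sumr; apply: ler_sum => X XA.
have c0 : 0 < 'C(#|D|, #|X|)%:R :> R.
  by rewrite ltr0n bin_gt0 subset_leq_card // sAD.
rewrite ler_pdivlMr // mul1r ler_pdivlMr //.
rewrite -(ler_pXn2r (_ : 0 < 2)%N) ?nnegrE ?exprn_ge0 ?mulr_ge0 ?sqrtr_ge0 //.
rewrite exprMn sqr_sqrtr ?ler0n // -exprM (mulnC #|D|) exprM.
by rewrite -!natrX -natrM ler_nat bin_sqr_le.
Qed.

(** * Antichains in the fibres of a switching operation *)

(* The fibres of [put set0] are Boolean lattices: [put T x] runs over the fibre
   of [x] when [T] runs over the subsets of [act x], and [on] recovers [T]. *)
Section Switching.

Variables (X I : finType) (act on : X -> {set I}) (put : {set I} -> X -> X).
Hypothesis act_put : forall T x, act (put T x) = act x.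
Hypothesis put_put : forall T T' x, put T (put T' x) = put T x.
Hypothesis put_on : forall x, put (on x) x = x.
Hypothesis on_put : forall T x, on (put T x) = T :&: act x.

(** On each fibre [on] maps [F] injectively onto an antichain of subsets of a k-set, so [F] has at
    most 2 ^ k / sqrt (k + 1) members there. The fibre has at least 2 ^ k points, each contributing
    1 / sqrt (k + 1) on the right. *)
Lemma card_switching_antichain (R : rcfType) (F : {set X}) :
    {in F, forall x (T : {set I}), on x \subset T -> T \subset act x -> put T x \in F ->
       put T x = x} ->
  #|F|%:R <= \sum_x (Num.sqrt #|act x|.+1%:R)^-1 :> R.
Proof.
move=> antiF.
have on_act x : on x \subset act x by rewrite -{1}(put_on x) on_put subsetIr.
have putE c x : put set0 x = c -> x = put (on x) c.
  by move=> <-; rewrite put_put put_on.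
rewrite (partition_big (put set0) predT) //=.
rewrite -sum1_card (partition_big (put set0) predT) //= natr_sum.
apply: ler_sum => c _.
(* Here [c] ranges over all of [X]. Empty fibres contribute 0 to both sides; otherwise [x0] shows
   that [c] is a value of [put set0]. *)
have [/pred0P e0|/pred0Pn[x0 /= /eqP x0c]] :=
    boolP (pred0b [pred x | put set0 x == c]).
  by rewrite !big_pred0 // => x; have /= := e0 x => ->; rewrite ?andbF.
have actc x : put set0 x = c -> act x = act c by move=> <-; rewrite act_put.
rewrite (eq_bigr (fun=> (Num.sqrt #|act c|.+1%:R)^-1)); last first.
  by move=> x /eqP/actc ->.
rewrite sum1dep_card sumr_const; set Fc := [set x in F | _].
have inj_on : {in [pred x | put set0 x == c] &, injective on}.
  by move=> x y /= /eqP/putE ex /eqP/putE ey e; rewrite ex ey e.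
have inj_onF : {in Fc &, injective on}.
  by move=> x y /setIdP[_ xc] /setIdP[_ yc]; apply: inj_on.
rewrite -(card_in_imset inj_onF).
apply: le_trans (@sperner_sqrt R I (act c) (on @: Fc) _ _) _.
- by move=> _ /imsetP[x /setIdP[_ /eqP/actc <-] ->].
- move=> _ _ /imsetP[x /setIdP[xF /eqP xc] ->] /imsetP[y /setIdP[yF /eqP yc] ->] sxy.
  have e : put (on y) x = y by rewrite (putE _ _ xc) put_put -(putE _ _ yc).
  have ayx : on y \subset act x by rewrite (actc _ xc) -(actc _ yc).
  by rewrite -(antiF _ xF _ sxy ayx) e.
rewrite -[leRHS]mulr_natl ler_wpM2r ?invr_ge0 ?sqrtr_ge0 //.
rewrite -natrX ler_nat -card_powerset.
rewrite -(card_in_imset (f := put^~ c) (D := mem (powerset (act c)))).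
  apply: subset_leq_card; apply/subsetP => _ /imsetP[T _ ->].
  by rewrite unfold_in /= -x0c !put_put; apply/eqP.
move=> T T'; rewrite !inE => /setIidPl eT /setIidPl eT' /(congr1 on).
by rewrite !on_put eT eT'.
Qed.

(* Double counting of the pairs [(i, y)] with [i \in act y], weighted by
   [1 / #|act y|]. *)
Lemma sum_inv_act (R : numFieldType) (N : nat) (fill : I -> X -> X) :
    (forall i x, i \in act (fill i x)) ->
    (forall i x, act (fill i x) \subset i |: act x) ->
    (forall i y, #|[set x | fill i x == y]| <= N)%N ->
  #|I|%:R * \sum_x (#|act x|.+1%:R)^-1 <= (N * #|X|)%:R :> R.
Proof.
move=> act_fill fill_act fibN.
have step i : \sum_x (#|act x|.+1%:R)^-1 <=
    N%:R * \sum_(y | i \in act y) (#|act y|%:R)^-1 :> R.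
  rewrite (partition_big (fill i) (fun y => i \in act y)) /=; last first.
    by move=> x _; apply: act_fill.
  rewrite mulr_sumr; apply: ler_sum => y iy.
  have y0 : 0 < #|act y|%:R :> R by rewrite ltr0n; apply/card_gt0P; exists i.
  (* Filling adds at most [i] to the active set, so |act y| <= |act x| + 1. *)
  apply: le_trans (_ : \sum_(x | fill i x == y) (#|act y|%:R)^-1 <= _).
    apply: ler_sum => x /eqP xy; rewrite lef_pV2 ?posrE ?y0 ?ltr0n // ler_nat.
    rewrite -xy; apply: leq_trans (subset_leq_card (fill_act i x)) _.
    by rewrite cardsU1; case: (_ \notin _).
  rewrite sumr_const -[leLHS]mulr_natl ler_wpM2r ?invr_ge0 ?ler0n // ler_nat.
  by move: (fibN i y); rewrite cardsE.
rewrite mulr_natl -sumr_const.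
apply: le_trans (ler_sum _ (fun i _ => step i)) _.
rewrite -mulr_sumr natrM ler_wpM2l ?ler0n //.
rewrite (exchange_big_dep predT) //= -sum1_card natr_sum.
apply: ler_sum => y _; rewrite sumr_const -[leLHS]mulr_natr mulrC.
have [->|y0] := eqVneq #|act y| 0%N; first by rewrite mul0r.
by rewrite mulfV ?pnatr_eq0.
Qed.

Lemma card_switching_antichain_sqrt (R : rcfType) (N : nat)
    (fill : I -> X -> X) (F : {set X}) :
    (0 < #|I|)%N -> (0 < N)%N ->
    (forall i x, i \in act (fill i x)) ->
    (forall i x, act (fill i x) \subset i |: act x) ->
    (forall i y, #|[set x | fill i x == y]| <= N)%N ->
    {in F, forall x (T : {set I}), on x \subset T -> T \subset act x -> put T x \in F ->
       put T x = x} ->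
  #|F|%:R <= N%:R * #|X|%:R / Num.sqrt #|I|%:R :> R.
Proof.
move=> I0 N0 act_fill fill_act fibN antiF.
apply: le_trans (card_switching_antichain R F antiF) _.
have H := @sum_inv_act R N fill act_fill fill_act fibN.
(* This [l] balances the two AM-GM terms: summed over [X], l / s ^ 2 and 1 / l each give at most N
   |X| / l, the former by [H]. *)
set l := Num.sqrt (#|I|%:R : R).
have l0 : 0 < l by rewrite sqrtr_gt0 ltr0n.
have ll : l ^+ 2 = #|I|%:R by rewrite sqr_sqrtr ?ler0n.
(* AM-GM: [2 / s <= l / s ^ 2 + 1 / l] *)
have amgm x : (Num.sqrt (#|act x|.+1%:R : R))^-1 <=
    (l * (#|act x|.+1%:R)^-1 + l^-1) / 2.
  set s := Num.sqrt _.
  have s0 : 0 < s by rewrite sqrtr_gt0 ltr0n.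
  rewrite -[_.+1%:R](@sqr_sqrtr R) ?ler0n // -/s.
  rewrite -subr_ge0 (_ : _ - _ = (l - s) ^+ 2 / (2 * l * s ^+ 2)).
    by rewrite divr_ge0 ?sqr_ge0 // !mulr_ge0 ?sqr_ge0 // ltW.
  by field; rewrite !gt_eqF.
apply: le_trans (ler_sum _ (fun x _ => amgm x)) _.
rewrite -mulr_suml big_split /= -mulr_sumr sumr_const -ll in H *.
set S := \sum_x _ in H *.
rewrite natrM in H.
have N1 : 1 <= N%:R :> R by rewrite ler1n.
have : l * S <= N%:R * #|X|%:R / l.
  by rewrite ler_pdivlMr // mulrAC -expr2.
have : l^-1 *+ #|X| <= N%:R * #|X|%:R / l.
  rewrite -[_ *+ _]mulr_natl ler_wpM2r ?invr_ge0 ?(ltW l0) //.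
  by rewrite ler_peMl ?ler0n.
lra.
Qed.

End Switching.

(** * Switching the active blocks of a set *)

(* [matching true Z] and [matching false Z] are the blocks met by [Z] exactly in
   their [side] part, resp. exactly in the complement of that part. *)
Section Blocks.

Variables (T I : finType) (blk : T -> option I) (side : T -> bool).
Hypothesis blk_neq0 : forall i, exists t, blk t = Some i.

Definition matching (b : bool) (Z : {set T}) : {set I} :=
  [set i | [forall t, (blk t == Some i) ==> ((t \in Z) == (side t == b))]].

Definition active (Z : {set T}) : {set I} := matching true Z :|: matching false Z.

(** Serves as [put], with [active] as [act] and [matching true] as [on]. Inactive blocks are kept so
    that the set of active blocks does not change. *)
Definition switch (W : {set I}) (Z : {set T}) : {set T} :=
  [set t | if blk t is Some i
           then if i \in active Z then side t == (i \in W) else t \in Z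
           else t \in Z].

Definition fill (i : I) (Z : {set T}) : {set T} :=
  [set t | if blk t == Some i then side t else t \in Z].

Lemma matchingP b (Z : {set T}) i :
  reflect (forall t, blk t = Some i -> (t \in Z) = (side t == b))
          (i \in matching b Z).
Proof.
rewrite inE; apply: (iffP forallP) => [h t e|h t].
  by apply/eqP; have := h t; rewrite e eqxx.
by apply/implyP => /eqP/h ->.
Qed.

Lemma eq_matching b (Z Z' : {set T}) i :
    (forall t, blk t = Some i -> (t \in Z) = (t \in Z')) ->
  (i \in matching b Z) = (i \in matching b Z').
Proof.
by move=> h; apply/matchingP/matchingP => h' t e; rewrite -h' // h.
Qed.

Lemma matching_switch b (W : {set I}) (Z : {set T}) i :
  (i \in matching b (switch W Z)) =
    if i \in active Z then (i \in W) == b else i \in matching b Z.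
Proof.
case: ifP => iA; last by apply: eq_matching => t e; rewrite inE e iA.
apply/matchingP/eqP => [h|<- t e]; last by rewrite inE e iA.
(* A point of the block is needed: an empty block would match both sides. *)
have [t e] := blk_neq0 i; have := h t e; rewrite inE e iA.
by case: (side t) (i \in W) b {h} => [] [] [].
Qed.

Lemma active_switch W Z : active (switch W Z) = active Z.
Proof.
apply/setP => i; rewrite [LHS]in_setU !matching_switch.
by case: ifP => [_|]; [case: (i \in W) | rewrite in_setU].
Qed.

Lemma switch_switch W W' Z : switch W (switch W' Z) = switch W Z.
Proof.
apply/setP => t; rewrite [LHS]in_set [RHS]in_set active_switch.
by case e: (blk t) => [i|]; [case: ifP => // iA|]; rewrite in_set e ?iA.
Qed.

Lemma switch_matching Z : switch (matching true Z) Z = Z.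
Proof.
apply/setP => t; rewrite inE; case e: (blk t) => [i|] //.
case: ifP => // /setUP iA; have [/matchingP/(_ t e) -> //|ni] := boolP (i \in _).
by case: iA => [iA|/matchingP/(_ t e) -> //]; rewrite iA in ni.
Qed.

Lemma matching_switchI W Z : matching true (switch W Z) = W :&: active Z.
Proof.
apply/setP => i; rewrite matching_switch in_setI andbC.
case: ifP; first by rewrite eqb_id.
by rewrite in_setU => /norP[/negbTE].
Qed.

Lemma active_fill i Z : i \in active (fill i Z).
Proof.
by apply/setUP; left; apply/matchingP => t e; rewrite inE e eqxx eqb_id.
Qed.

Lemma sub_active_fill i Z : active (fill i Z) \subset i |: active Z.
Proof.
apply/subsetP => j; rewrite in_setU1; have [//|ji] := eqVneq j i.
by rewrite !in_setU !(@eq_matching _ (fill i Z) Z) // => t e;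
  rewrite inE e (inj_eq Some_inj) (negbTE ji).
Qed.

(** Outside block [i] nothing is overwritten, so a member of the fibre is determined by its trace on
    that block. *)
Lemma card_fill_fibre i (Y : {set T}) :
  (#|[set Z | fill i Z == Y]| <= 2 ^ #|[set t | blk t == Some i]|)%N.
Proof.
set B := [set t | blk t == _]; rewrite -card_powerset.
have inj : {in [set Z | fill i Z == Y] &, injective (fun Z => Z :&: B)}.
  move=> Z Z'; rewrite !inE => /eqP <- /eqP/setP e /setP e'; apply/setP => t.
  have := e t; have := e' t; rewrite !inE.
  by case: (blk t == _) => /=; rewrite ?andbT.
rewrite -(card_in_imset inj); apply: subset_leq_card.
by apply/subsetP => _ /imsetP[Z _ ->]; rewrite inE subsetIr.
Qed.

(** As [W] contains the blocks already matching [side], the only blocks that change are those turned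
    from the complement to the [side] part: all gains lie in [side], all losses outside it. *)
Lemma switch_setD (W : {set I}) (Z : {set T}) (t : T) : matching true Z \subset W ->
  ((t \in switch W Z :\: Z) =
    (if blk t is Some i then i \in (W :\: matching true Z) :&: active Z else false)
      && side t) *
  ((t \in Z :\: switch W Z) =
    (if blk t is Some i then i \in (W :\: matching true Z) :&: active Z else false)
      && ~~ side t).
Proof.
move=> /subsetP sW; rewrite !(in_setD _ _ t) [t \in switch W Z]in_set.
case e: (blk t) => [i|]; last by rewrite andNb.
rewrite in_setI in_setD.
have [iA|_] := boolP (i \in active Z); last by rewrite andbF andNb.
have [iO|iO] /= := boolP (i \in matching true Z).
  by rewrite (sW _ iO) (matchingP _ _ _ iO) //; case: (side t).
have iF : i \in matching false Z by move: iA; rewrite in_setU (negbTE iO).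
by rewrite (matchingP _ _ _ iF) //; case: (side t) (i \in W) => [] [].
Qed.

Lemma card_blocks (V : {set I}) (a : pred T) :
  #|[pred t | (if blk t is Some i then i \in V else false) && a t]| =
  (\sum_(i in V) #|[set t | (blk t == Some i) && a t]|)%N.
Proof.
rewrite -sum1_card.
under [RHS]eq_bigr do rewrite -sum1dep_card.
rewrite (exchange_big_dep
  (fun t => (if blk t is Some i then i \in V else false) && a t)) /=.
  apply: eq_bigr => t /andP[]; case e: (blk t) => [i|] // iV at_.
  rewrite (big_pred1 i) // => j.
  by apply/andP/eqP => [[_ /andP[/eqP[] //]]|->]; rewrite iV eqxx.
by move=> i t iV /andP[/eqP -> ->]; rewrite iV.
Qed.

Lemma card_block_switching_antichain (R : rcfType) (s : nat) (F : {set {set T}}) :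
    (0 < #|I|)%N -> (forall i, #|[set t | blk t == Some i]| <= s)%N ->
    {in F, forall Z (W : {set I}), matching true Z \subset W ->
       W \subset active Z -> switch W Z \in F -> switch W Z = Z} ->
  #|F|%:R <= 2 ^+ s * 2 ^+ #|T| / Num.sqrt #|I|%:R :> R.
Proof.
move=> I0 les antiF.
have := @card_switching_antichain_sqrt _ I active (matching true) switch
  active_switch switch_switch switch_matching matching_switchI R (2 ^ s) fill F.
have cT : #|{set T}| = (2 ^ #|T|)%N.
  by have := card_powerset [set: T]; rewrite powersetT !cardsT.
rewrite -!natrX cT; apply=> //.
- by rewrite expn_gt0.
- exact: active_fill.
- exact: sub_active_fill.
by move=> i Y; apply: leq_trans (card_fill_fibre i Y) _; rewrite leq_exp2l.
Qed.

End Blocks.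

(** * Residue classes as blocks, and the final bound *)

Lemma card_residue_range (n m a c : nat) (i : 'I_m) : ((a + c) * m <= n)%N ->
  #|[set t : 'I_n | (t %% m == i) && (a * m <= t < (a + c) * m)]|%N = c.
Proof.
move=> le_n; have m0 : (0 < m)%N by apply: leq_trans (ltn_ord i).
have lt_n (j : 'I_c) : ((a + j) * m + i < n)%N.
  by have := ltn_ord j; have := ltn_ord i; nia.
pose f j : 'I_n := Ordinal (lt_n j).
have f_inj : injective f.
  move=> j k /(congr1 val) /= /addIn /eqP; rewrite eqn_pmul2r // eqn_add2l.
  by move/eqP/val_inj.
rewrite -[RHS]card_ord -(card_imset predT f_inj); apply: eq_card => t.
rewrite inE; apply/andP/imsetP => [[/eqP ti /andP[at_ tac]]|[j _ ->]] /=.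
  have lt_c : (t %/ m - a < c)%N.
    by rewrite ltn_subLR ?leq_divRL // ltn_divLR.
  exists (Ordinal lt_c) => //; apply: val_inj => /=.
  by rewrite subnKC ?leq_divRL // -ti -divn_eq.
rewrite modnMDl modn_small // eqxx; split=> //.
by have := ltn_ord j; have := ltn_ord i; nia.
Qed.

(* The [i]-th block consists of the [t < (p + q) * m] congruent to [i] modulo [m];
   each block has [p] elements below [p * m] and [q] elements above. *)
Lemma card_tilted_sperner_patterns (R : rcfType) (p q n m : nat)
    (FF : {set {set 'I_n}}) :
    (0 < p + q)%N -> (0 < m)%N -> ((p + q) * m <= n)%N ->
    tilted_sperner_patterns p q FF ->
  #|FF|%:R <= 2 ^+ (p + q) * 2 ^+ n / Num.sqrt m%:R :> R.
Proof.
move=> pq0 m0 le_n tFF.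
pose blk (t : 'I_n) : option 'I_m :=
  if (t < (p + q) * m)%N then insub (t %% m)%N else None.
pose side (t : 'I_n) := (p * m <= t)%N.
have blkE t i : (blk t == Some i) = (t %% m == i)%N && (t < (p + q) * m)%N.
  rewrite /blk; case: ifP => _; rewrite ?andbF // andbT insubT ?ltn_mod //.
have high i : #|[set t | (blk t == Some i) && side t]| = q.
  rewrite -[RHS](@card_residue_range n m p q i) //; apply: eq_card => t.
  by rewrite !inE blkE /side -andbA [(_ && (p * m <= t))%N]andbC.
have low i : #|[set t | (blk t == Some i) && ~~ side t]| = p.
  rewrite -[RHS](@card_residue_range n m 0 p i) ?add0n; last by nia.
  apply: eq_card => t; rewrite !inE blkE /side -ltnNge mul0n leq0n /=.
  by rewrite -andbA; congr (_ && _); apply/andP/idP => [[]|h] //; split=> //; nia.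
have block i : #|[set t | blk t == Some i]| = (p + q)%N.
  rewrite -(cardsID [set t | side t]) addnC.
  congr (_ + _)%N; [rewrite -[RHS](low i) | rewrite -[RHS](high i)];
  by apply: eq_card => t; rewrite !inE // andbC.
have blk_neq0 i : exists t, blk t = Some i.
  have : (0 < #|[set t | blk t == Some i]|)%N by rewrite block.
  by case/card_gt0P => t; rewrite inE => /eqP; exists t.
rewrite -[in 2 ^+ n](card_ord n) -[in m%:R](card_ord m).
apply: (@card_block_switching_antichain _ _ blk side blk_neq0).
- by rewrite card_ord.
- by move=> i; rewrite block.
move=> Z ZF W sW Wact SF; apply/eqP/negP => /negP neq; apply: tFF.
(* The switched set plays F. Each block of [V] trades its p low elements for its q high ones, so
   both sides of the cardinality condition are p q |V|. *)
exists (switch _ _ blk side W Z), Z; split=> //; first exact/eqP.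
  set V := (W :\: matching _ _ blk side true Z) :&: active _ _ blk side Z.
  rewrite (eq_card (fun t => (@switch_setD _ _ blk side W Z t sW).1)).
  rewrite (eq_card (fun t => (@switch_setD _ _ blk side W Z t sW).2)).
  rewrite !card_blocks (eq_bigr _ (fun i _ => high i)).
  by rewrite (eq_bigr _ (fun i _ => low i)) !sum_nat_const; nia.
move=> f g; rewrite !switch_setD // => /andP[_ hf] /andP[_].
by rewrite -ltnNge => hg; apply: leq_trans hf.
Qed.

Theorem theorem1p5 (R : realType) (p q : nat) (hpq : (0 < p + q)%N) :
  exists C : R, forall (n : nat) (FF : {set {set 'I_n}}),
    (2 <= n)%N -> tilted_sperner_patterns p q FF ->
    (#|FF|%:R : R) <= C * Num.sqrt (ln (n%:R : R)) * (2 ^+ n / Num.sqrt (n%:R : R)).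
Proof.
set s := (p + q)%N in hpq *.
(* The factor 2 ^ s is the fibre bound for [fill]; sqrt (2 s) comes from n <= 2 s (n %/ s), valid
   for n >= s. For n < s no block fits, and the trivial bound 2 ^ n suffices. *)
pose K : R := 2 ^+ s * Num.sqrt (2 * s)%:R.
have K0 : 0 <= K by rewrite mulr_ge0 ?exprn_ge0 ?sqrtr_ge0.
have ln2 : 0 < ln 2 :> R by rewrite ln_gt0 // ltr1n.
(* Since ln n >= ln 2, dividing by sqrt (ln 2) lets the logarithmic factor be inserted into the
   log-free bound. *)
exists (K / Num.sqrt (ln 2)) => n FF n2 tFF.
have n0 : 0 < Num.sqrt (n%:R : R) by rewrite sqrtr_gt0 ltr0n; lia.
have bound : #|FF|%:R <= K * (2 ^+ n / Num.sqrt n%:R) :> R.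
  have [lt_ns|le_sn] := ltnP n s.
    apply: le_trans (_ : 2 ^+ n <= _).
      rewrite -natrX ler_nat; apply: leq_trans (max_card _) _.
      by have := card_powerset [set: 'I_n]; rewrite powersetT !cardsT card_ord => ->.
    rewrite mulrA ler_pdivlMr // [leRHS]mulrC ler_wpM2l ?exprn_ge0 //.
    apply: le_trans (_ : Num.sqrt (2 * s)%:R <= _).
      by rewrite ler_wsqrtr // ler_nat; lia.
    by rewrite ler_peMl ?sqrtr_ge0 // exprn_ege1 // ler1n.
  have m0 : (0 < n %/ s)%N by rewrite divn_gt0.
  have le_n : (s * (n %/ s) <= n)%N by rewrite mulnC leq_trunc_div.
  apply: le_trans (@card_tilted_sperner_patterns R p q n _ FF hpq m0 le_n tFF) _.
  rewrite /K -!mulrA ler_wpM2l ?exprn_ge0 // mulrCA ler_wpM2l ?exprn_ge0 //.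
  rewrite ler_pdivlMr // mulrC ler_pdivrMr ?sqrtr_gt0 ?ltr0n //.
  rewrite -sqrtrM ?ler0n // ler_wsqrtr // -natrM ler_nat.
  by have := divn_eq n s; have := ltn_pmod n hpq; nia.
apply: le_trans bound _.
rewrite ler_wpM2r ?divr_ge0 ?exprn_ge0 ?sqrtr_ge0 //.
rewrite mulrAC ler_pdivlMr ?sqrtr_gt0 // ler_wpM2l // ler_wsqrtr //.
by rewrite ler_ln ?posrE ?ltr0n ?ler_nat //; lia.
Qed.
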